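(* Let $T>0$, $A\in\mathbb{R}^{n\times n}$, $B\in\mathbb{R}^{n\times m}$, $C\in\mathbb{R}^{m\times n}$, $D\in\mathbb{R}^{m\times m}$, $v:[0,T]\to\mathbb{R}^m$, and let $\mathcal{P}:\mathbb{R}^m\rightrightarrows\mathbb{R}^m$ be $\mathcal{P}(\zeta)=\{\eta:\eta\ge0,\ \zeta\le0,\ \langle\eta,\zeta\rangle=0\}$ (inequalities componentwise). Define $H_{\mathcal{P}}(t,x)=-Ax+B(\mathcal{P}+D)^{-1}\big(Cx+v(t)\big)$. Suppose that (i) $\Sigma(A,B,C,D)$ is passive with storage function $x\mapsto\frac12x^Tx$; (ii) $\operatorname{im}C\cap\operatorname{rint}\big(\operatorname{im}(\mathcal{P}+D)-v(t)\big)\neq\emptyset$ for all $t\in[0,T]$; (iii) $v\in AC([0,T],\mathbb{R}^m)$. Then $H_{\mathcal{P}}$ satisfies: (A1) for each $t\in[0,T]$, $H_{\mathcal{P}}(t,\cdot)$ is maximal monotone; (A2) there exists a nondecreasing absolutely continuous $\varphi:[0,T]\to\mathbb{R}$ with $\sup_{z\in\operatorname{dom}H_{\mathcal{P}}(s,\cdot)}\operatorname{dist}\big(z,\operatorname{dom}H_{\mathcal{P}}(t,\cdot)\big)\le\varphi(t)-\varphi(s)$ for all $0\le s\le t\le T$; (A3) for every $r>0$ there exists $\sigma_r\in L_1([0,T],\mathbb{R}_+)$ with $|H_{\mathcal{P}}^0(t,x)|\le\sigma_r(t)(1+|x|)$ for all $t\in[0,T]$, $x\in\mathbb{B}^n(r)\cap\operatorname{dom}H_{\mathcal{P}}(t,\cdot)$;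 (A4) $t\mapsto\operatorname{graph}H_{\mathcal{P}}(t,\cdot)$ is outer semicontinuous on $[0,T]$.
   Context: $(\mathcal{P}+D)(z)=\mathcal{P}(z)+Dz$, $(\mathcal{P}+D)^{-1}(\eta)=\{z:\eta\in\mathcal{P}(z)+Dz\}$; $\operatorname{im}G=\bigcup_xG(x)$, $\operatorname{dom}G=\{x:G(x)\ne\emptyset\}$, $\operatorname{graph}G=\{(x,y):y\in G(x)\}$; $\operatorname{rint}$ is relative interior; $\mathbb{B}^n(r)$ the closed Euclidean ball; $\operatorname{dist}(x,S)=\inf_{y\in S}|x-y|$; $H^0_{\mathcal{P}}(t,x)$ is the least-norm element of $H_{\mathcal{P}}(t,x)$. The system $\Sigma(A,B,C,D)$ is $\dot x=Ax+Bz$, $w=Cx+Dz$; passivity with storage $V(x)=\frac12x^Tx$ means $V(x(t_1))+\int_{t_1}^{t_2}z^Tw\,d\tau\le V(x(t_2))$ for all $t_1<t_2$ and all trajectories $(z,x,w)\in L_2\times AC\times L_2$ (equivalently $\begin{bmatrix}A^T+A & B-C^T\\ B^T-C & -(D+D^T)\end{bmatrix}\le0$). Outer semicontinuity at $t^*$: if $t_\ell\to t^*$, $(x_\ell,y_\ell)\in\operatorname{graph}H_{\mathcal{P}}(t_\ell,\cdot)$, $(x_\ell,y_\ell)\to(x,y)$, then $(x,y)\in\operatorname{graph}H_{\mathcal{P}}(t^*,\cdot)$. *)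

(* Defs.v *)
From HB Require Import structures.
From mathcomp Require Import all_boot all_order all_algebra.
From mathcomp Require Import all_classical all_reals all_analysis.
Set Implicit Arguments. Unset Strict Implicit. Unset Printing Implicit Defensive.
Import Order.TTheory GRing.Theory Num.Theory.
Import numFieldNormedType.Exports.
Local Open Scope classical_set_scope.
Local Open Scope ring_scope.

Section Defs.
Variable R : realType.

Definition dotv k (u w : 'cV[R]_k) : R := \sum_(i < k) u i 0 * w i 0.
Definition normv k (u : 'cV[R]_k) : R := Num.sqrt (dotv u u).

Definition domS p q (G : 'cV[R]_p -> set 'cV[R]_q) : set 'cV[R]_p :=
  [set x | exists y, G x y].
Definition imS p q (G : 'cV[R]_p -> set 'cV[R]_q) : set 'cV[R]_q :=
  [set y | exists x, G x y].

Definition monotoneS k (G : 'cV[R]_k -> set 'cV[R]_k) : Prop :=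
  forall x1 y1 x2 y2, G x1 y1 -> G x2 y2 -> 0 <= dotv (y1 - y2) (x1 - x2).
Definition maximal_monotone k (G : 'cV[R]_k -> set 'cV[R]_k) : Prop :=
  monotoneS G /\
  forall G' : 'cV[R]_k -> set 'cV[R]_k, monotoneS G' ->
    (forall x y, G x y -> G' x y) -> forall x y, G' x y -> G x y.

Definition complP m (zeta : 'cV[R]_m) : set 'cV[R]_m :=
  [set et : 'cV[R]_m | (forall i, 0 <= et i 0) /\ (forall i, zeta i 0 <= 0)
             /\ dotv et zeta = 0].

Definition PplusD m (D : 'M[R]_m) (z : 'cV[R]_m) : set 'cV[R]_m :=
  [set et : 'cV[R]_m | exists e, complP z e /\ et = e + D *m z].
Definition PplusD_inv m (D : 'M[R]_m) (et : 'cV[R]_m) : set 'cV[R]_m :=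
  [set z | PplusD D z et].

Definition HP n m (A : 'M[R]_n) (B : 'M[R]_(n, m)) (C : 'M[R]_(m, n))
  (D : 'M[R]_m) (v : R -> 'cV[R]_m) (t : R) (x : 'cV[R]_n) : set 'cV[R]_n :=
  [set y | exists z, PplusD_inv D (C *m x + v t) z /\ y = - (A *m x) + B *m z].

Definition aff_hull k (S : set 'cV[R]_k) : set 'cV[R]_k :=
  [set y | exists (N : nat) (p : 'I_N -> 'cV[R]_k) (c : 'I_N -> R),
      (forall i, S (p i)) /\ \sum_(i < N) c i = 1 /\ y = \sum_(i < N) c i *: p i].
Definition rint k (S : set 'cV[R]_k) : set 'cV[R]_k :=
  [set x | S x /\ exists eps : R, 0 < eps /\
      forall y, aff_hull S y -> normv (y - x) < eps -> S y].

(* Euclidean distance to a set, in the extended reals (dist(x, ∅) = +oo) *)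
Definition distS k (x : 'cV[R]_k) (S : set 'cV[R]_k) : \bar R :=
  ereal_inf [set (normv (x - y))%:E | y in S].

(* passivity of Σ(A,B,C,D) with storage x |-> x^T x / 2, via the matrix
   inequality [A^T+A, B-C^T; B^T-C, -(D+D^T)] <= 0 (negative semidefinite) *)
Definition passive_half n m (A : 'M[R]_n) (B : 'M[R]_(n, m)) (C : 'M[R]_(m, n))
  (D : 'M[R]_m) : Prop :=
  forall u : 'cV[R]_(n + m),
    (u^T *m block_mx (A^T + A) (B - C^T) (B^T - C) (- (D + D^T)) *m u) 0 0 <= 0.

Definition abs_cont_vec k (a b : R) (f : R -> 'cV[R]_k) : Prop :=
  forall eps : R, 0 < eps -> exists delta : R, 0 < delta /\
    forall (N : nat) (l r : 'I_N -> R),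
      (forall i, a <= l i /\ l i <= r i /\ r i <= b) ->
      (forall i j, i != j -> r i <= l j \/ r j <= l i) ->
      \sum_(i < N) (r i - l i) < delta ->
      \sum_(i < N) normv (f (r i) - f (l i)) < eps.
Definition abs_cont (a b : R) (f : R -> R) : Prop :=
  forall eps : R, 0 < eps -> exists delta : R, 0 < delta /\
    forall (N : nat) (l r : 'I_N -> R),
      (forall i, a <= l i /\ l i <= r i /\ r i <= b) ->
      (forall i j, i != j -> r i <= l j \/ r j <= l i) ->
      \sum_(i < N) (r i - l i) < delta ->
      \sum_(i < N) `|f (r i) - f (l i)| < eps.

End Defs.

(* Main.v *)
(* Write F for the linear map (e, z) |-> (e + D z, B z). The graph of H(t, .) is
   the preimage, under a map affine in (x, y) and v(t), of the image by F of the
   cone of pairs with e >= 0, z <= 0, e . z = 0. Everything rests on a conformal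
   Hoffman lemma: for every matrix F there is c such that each d can be replaced
   by d' with F d' = F d, |d'| <= c |F d| and every coordinate of d' between 0
   and that of d. Conformity preserves signs and complementarity, so
   - the image of the cone is closed, which is (A4);
   - solutions z can be chosen bounded by |C x + v(t)|, hence a constant sigma
     in (A3);
   - applied to the difference of a solution at time s and one at time t, it
     shows that the domain moves by at most a constant times |v(t) - v(s)|, so
     that phi in (A2) is a multiple of the total variation of v.
   For (A1), Minty's criterion reduces maximality to a linear complementarity
   problem whose matrix D + C (I - A)^-1 B is positive semidefinite; it is
   solved by regularisation. *)

Require Import Defs.
From HB Require Import structures.
From mathcomp Require Import all_boot all_order all_algebra.
From mathcomp Require Import all_classical all_reals all_analysis.
From mathcomp Require Import ring lra.
Set Implicit Arguments.
Unset Strict Implicit.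
Unset Printing Implicit Defensive.
Import Order.TTheory GRing.Theory Num.Theory.
Import numFieldNormedType.Exports.
Local Open Scope classical_set_scope.
Local Open Scope ring_scope.

(** * Sup norm of matrices, continuity and compactness *)

Lemma le_mx_norm (R : realType) p q (M : 'M[R]_(p, q)) i j : `|M i j| <= `|M|.
Proof.
rewrite [leRHS]/Num.Def.normr /= mx_normrE.
exact: (le_bigmax _ (fun ij : 'I_p * 'I_q => `|M ij.1 ij.2|) (i, j)).
Qed.

Lemma mx_norm_le (R : realType) p q (M : 'M[R]_(p, q)) (a : R) : 0 <= a ->
  (forall i j, `|M i j| <= a) -> `|M| <= a.
Proof.
move=> a0 Ma; rewrite [leLHS]/Num.Def.normr /= mx_normrE.
by apply/bigmax_leP; split=> // -[i j] _; exact: Ma.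
Qed.

Lemma mx_norm_mul (R : realType) p q r (F : 'M[R]_(p, q)) (M : 'M[R]_(q, r)) :
  `|F *m M| <= q%:R * `|F| * `|M|.
Proof.
apply: mx_norm_le => [|i j]; first by rewrite !mulr_ge0.
rewrite mxE (le_trans (ler_norm_sum _ _ _))//.
rewrite -mulrA mulr_natl -[X in _ *+ X]card_ord -sumr_const.
apply: ler_sum => k _; rewrite normrM.
by apply: ler_pM => //; exact: le_mx_norm.
Qed.

Lemma lipschitz_continuous_norm (R : realType) (V W : normedModType R) (c : R)
    (f : V -> W) : (forall x y, `|f x - f y| <= c * `|x - y|) -> continuous f.
Proof.
move=> fc x B /= /(nbhs_ballP (f x))[e /= e0 eB]; apply/nbhs_ballP.
have c0 : 0 < `|c| + 1 by rewrite ltr_wpDl.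
exists ((`|c| + 1)^-1 * e) => /=; first by rewrite mulr_gt0 ?invr_gt0.
move=> y; rewrite -ball_normE /= ltr_pdivlMl// => xy; apply: eB.
rewrite -ball_normE /= (le_lt_trans (fc _ _))//; apply: le_lt_trans xy.
by rewrite ler_wpM2r// (le_trans (ler_norm c))// lerDl.
Qed.

Lemma mulmx_continuous (R : realType) p q r (F : 'M[R]_(p, q)) :
  continuous (fun M : 'M[R]_(q, r) => F *m M).
Proof.
apply: (@lipschitz_continuous_norm _ _ _ (q%:R * `|F|)) => M N.
by rewrite -mulmxBr; exact: mx_norm_mul.
Qed.

Lemma trmx_continuous (R : realType) p q :
  continuous (fun M : 'M[R]_(p, q) => M^T).
Proof.
apply: (@lipschitz_continuous_norm _ _ _ 1) => M N; rewrite mul1r.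
apply: mx_norm_le => // i j; rewrite !mxE.
by have := le_mx_norm (M - N) j i; rewrite !mxE.
Qed.

(** Heine-Borel, carried from row vectors to column vectors by transposition. *)
Lemma cV_bounded_closed_compact (R : realType) k (S : set 'cV[R]_k) (b : R) :
  (forall u, S u -> `|u| <= b) -> closed S -> compact S.
Proof.
move=> Sb Scl; set S' := (fun M : 'rV[R]_k => M^T) @^-1` S.
have S'c : compact S'.
  apply: bounded_closed_compact; last first.
    by apply: closed_comp => // M _; exact: trmx_continuous.
  exists b; split; first exact: num_real.
  move=> a ba M /Sb Mb; apply: le_trans (le_trans Mb (ltW ba)).
  apply: mx_norm_le => // i j.
  by have := le_mx_norm M^T j i; rewrite mxE.
rewrite (_ : S = (fun M : 'rV[R]_k => M^T) @` S'); last first.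
  apply/seteqP; split=> [u Su|u [M ? <-]//].
  by exists u^T; rewrite ?trmxK// /S'/= trmxK.
apply: continuous_compact => //; apply: continuous_subspaceT.
exact: trmx_continuous.
Qed.

(** * Euclidean inner product, and its norm compared with the sup norm *)

Section Euclidean.
Variables (R : realType) (k : nat).
Implicit Types u w : 'cV[R]_k.

Lemma dotvE u w : dotv u w = (u^T *m w) 0 0.
Proof. by rewrite mxE; apply: eq_bigr => i _; rewrite mxE. Qed.

Lemma dotvC u w : dotv u w = dotv w u.
Proof. by apply: eq_bigr => i _; rewrite mulrC. Qed.

Lemma dotvDl u1 u2 w : dotv (u1 + u2) w = dotv u1 w + dotv u2 w.
Proof. by rewrite -big_split; apply: eq_bigr => i _; rewrite mxE mulrDl. Qed.

Lemma dotvZl a u w : dotv (a *: u) w = a * dotv u w.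
Proof. by rewrite /dotv mulr_sumr; apply: eq_bigr => i _; rewrite mxE mulrA. Qed.

Lemma dotvNl u w : dotv (- u) w = - dotv u w.
Proof. by rewrite -scaleN1r dotvZl mulN1r. Qed.

Lemma dotvBl u1 u2 w : dotv (u1 - u2) w = dotv u1 w - dotv u2 w.
Proof. by rewrite dotvDl dotvNl. Qed.

Lemma dotvDr u w1 w2 : dotv u (w1 + w2) = dotv u w1 + dotv u w2.
Proof. by rewrite dotvC dotvDl !(dotvC u). Qed.

Lemma dotvZr a u w : dotv u (a *: w) = a * dotv u w.
Proof. by rewrite dotvC dotvZl dotvC. Qed.

Lemma dotvNr u w : dotv u (- w) = - dotv u w.
Proof. by rewrite dotvC dotvNl dotvC. Qed.

Lemma dotvBr u w1 w2 : dotv u (w1 - w2) = dotv u w1 - dotv u w2.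
Proof. by rewrite dotvDr dotvNr. Qed.

Lemma dotvv_ge0 u : 0 <= dotv u u.
Proof. by apply: sumr_ge0 => i _; rewrite -expr2 sqr_ge0. Qed.

Lemma dotv0l w : dotv 0 w = 0.
Proof. by rewrite -(scale0r w) dotvZl mul0r. Qed.

Lemma dotv_eq0 u : dotv u u = 0 -> u = 0.
Proof.
move=> u0; apply/matrixP => i j; rewrite ord1 mxE; apply/eqP.
rewrite -sqrf_eq0 expr2; apply/eqP.
have ge0 (l : 'I_k) : true -> 0 <= u l 0 * u l 0 by rewrite -expr2 sqr_ge0.
exact: (psumr_eq0P ge0 u0).
Qed.

(** Expand [|2 a u - w|^2 >= 0] and divide by [4 a]. *)
Lemma dotv_young (a : R) u w : 0 < a ->
  dotv u w <= a * dotv u u + a^-1 * dotv w w / 4.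
Proof.
move=> a0; have := dotvv_ge0 ((2 * a) *: u - w).
rewrite dotvBl !dotvBr !dotvZl !dotvZr (dotvC w u) => h.
rewrite -(ler_pM2l (_ : 0 < 4 * a)) ?mulr_gt0// mulrDr.
have -> : 4 * a * (a^-1 * dotv w w / 4) = dotv w w by field; rewrite gt_eqF.
nra.
Qed.

Lemma normv_coord u i : `|u i 0| <= normv u.
Proof.
rewrite -sqrtr_sqr; apply: ler_wsqrtr; rewrite /dotv (bigD1 i)//= expr2 lerDl.
by apply: sumr_ge0 => j _; rewrite -expr2 sqr_ge0.
Qed.

Lemma mx_norm_le_normv u : `|u| <= normv u.
Proof.
by apply: mx_norm_le => [|i j]; [exact: sqrtr_ge0|rewrite ord1 normv_coord].
Qed.

Lemma dotv_le_mx_norm u : dotv u u <= k%:R * `|u| ^+ 2.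
Proof.
rewrite mulr_natl -[X in _ *+ X]card_ord -sumr_const; apply: ler_sum => i _.
by rewrite -expr2 -real_normK ?num_real// lerXn2r ?nnegrE// le_mx_norm.
Qed.

Lemma mx_norm_le_dotv u : `|u| ^+ 2 <= dotv u u.
Proof.
rewrite -[leRHS]sqr_sqrtr ?dotvv_ge0// lerXn2r ?nnegrE ?sqrtr_ge0//.
exact: mx_norm_le_normv.
Qed.

Lemma normv_le_mx_norm u : normv u <= k%:R * `|u|.
Proof.
rewrite -[leRHS]ger0_norm ?mulr_ge0// -sqrtr_sqr; apply: ler_wsqrtr.
rewrite (le_trans (dotv_le_mx_norm u))// exprMn ler_wpM2r ?sqr_ge0//.
by case: k => [|l]; rewrite ?expr0n// expr2 ler_peMr// ler1n.
Qed.

Lemma normv_le_sum u : normv u <= \sum_(i < k) `|u i 0|.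
Proof.
have s0 : 0 <= \sum_(i < k) `|u i 0| by exact: sumr_ge0.
rewrite -[leRHS]ger0_norm// -sqrtr_sqr; apply: ler_wsqrtr.
rewrite expr2 mulr_suml; apply: ler_sum => i _.
rewrite (le_trans (ler_norm _))// normrM ler_wpM2l// (bigD1 i)//= lerDl.
exact: sumr_ge0.
Qed.

End Euclidean.

Lemma dotv_mul (R : realType) p q (F : 'M[R]_(p, q)) u w :
  dotv u (F *m w) = dotv (F^T *m u) w.
Proof. by rewrite !dotvE trmx_mul trmxK mulmxA. Qed.

Lemma normv_continuous (R : realType) k : continuous (@normv R k).
Proof.
move=> u; rewrite /normv; apply: continuous_comp; last exact: sqrt_continuous.
rewrite /dotv; apply: continuous_big => [|i _ {}u].
  by move=> x; exact: add_continuous.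
by apply: continuousM; exact: coord_continuous.
Qed.

Lemma closed_approx (R : realType) (V : normedModType R) (S : set V) (x : V) :
  closed S -> (forall e, 0 < e -> exists2 y, S y & `|y - x| < e) -> S x.
Proof.
move=> Scl h; apply: Scl => B /nbhs_ballP [e /= e0 eB].
have [y Sy yx] := h _ e0; exists y; split=> //; apply: eB.
by rewrite -ball_normE /= distrC.
Qed.

(** * A conformal Hoffman lemma *)

Lemma closed_setforall (T : topologicalType) (I : Type) (P : I -> set T) :
  (forall i, closed (P i)) -> closed [set x | forall i, P i x].
Proof.
move=> Pcl; rewrite (_ : mkset _ = \bigcap_(i in setT) P i).
  exact: closed_bigI.
by apply/seteqP; split=> [x Px i _|x Px i]; exact: Px.
Qed.

Lemma closed_coord (R : realType) k (i : 'I_k) (P : set R) :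
  closed P -> closed [set u : 'cV[R]_k | P (u i 0)].
Proof. by move=> Pcl; apply: closed_comp => // u _; exact: coord_continuous. Qed.

Section Conformal.
Variables (R : realType) (p k : nat).
Implicit Types (F : 'M[R]_(p, k)) (u d : 'cV[R]_k).

Definition conformal d' d :=
  forall i, 0 <= d' i 0 <= d i 0 \/ d i 0 <= d' i 0 <= 0.

Definition nonneg u := forall i, 0 <= u i 0.

(** By compactness, this condition makes [|F u|] at least a positive multiple of [|u|] on the face
    of the nonnegative orthant carried by [a]. *)
Definition pointed F (a : {set 'I_k}) := forall u, nonneg u ->
  (forall i, i \notin a -> u i 0 = 0) -> F *m u = 0 -> u = 0.

Definition supp u : {set 'I_k} := finset (fun i => u i 0 != 0).

(* Subtracting the largest admissible multiple of a nonnegative kernel vector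
   supported in [supp u] makes one more coordinate of [u] vanish. *)
Lemma pointed_reduction F u : nonneg u ->
  exists u', [/\ nonneg u', forall i, u' i 0 <= u i 0, F *m u' = F *m u &
    pointed F (supp u')].
Proof.
have [N] := ubnP #|supp u|; elim: N u => // N IH u ltN u0.
have [irr|] := pselect (pointed F (supp u)); first by exists u.
move=> /existsNP[d /not_implyP[d0 /not_implyP[du /not_implyP[Fd dn0]]]].
have [i0 di0] : exists i, d i 0 != 0.
  apply: contrapT => /forallNP h; apply: dn0; apply/matrixP => i j.
  by rewrite ord1 mxE; apply/eqP; have /negP := h i; rewrite negbK.
have dgt i : d i 0 != 0 -> 0 < d i 0 by rewrite lt_def => ->; exact: d0.
have [i di imin] := @Order.TotalTheory.arg_minP _ R _ i0 (fun i => d i 0 != 0)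
  (fun i => u i 0 / d i 0) di0.
set t := u i 0 / d i 0 in imin.
have t0 : 0 <= t by rewrite divr_ge0// ltW// dgt.
set u1 := u - t *: d.
have u1E j : u1 j 0 = u j 0 - t * d j 0 by rewrite !mxE.
have u1u j : u1 j 0 <= u j 0 by rewrite u1E gerBl mulr_ge0.
have u10 : nonneg u1.
  move=> j; rewrite u1E subr_ge0; have [->|dj] := eqVneq (d j 0) 0.
    by rewrite mulr0.
  by rewrite -ler_pdivlMr ?dgt// imin.
have lt1 : (#|supp u1| < N)%N.
  rewrite (leq_trans _ (ltN : #|supp u| <= N)%N)//; apply: proper_card.
  apply/properP; split.
    apply/fintype.subsetP => j; rewrite !inE; apply: contra => /eqP uj.
    by rewrite eq_le u10 (le_trans (u1u j))// uj.
  exists i; rewrite inE; last by rewrite negbK u1E divfK ?subrr.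
  by apply: contra di => /eqP ui; rewrite du// inE ui eqxx.
have [u' [u'0 u'u Fu' irr]] := IH _ lt1 u10.
exists u'; split=> // [j|]; first exact: le_trans (u1u j).
by rewrite Fu' mulmxBr -scalemxAr Fd scaler0 subr0.
Qed.

(** The unit slice of the face is compact, so [|F u|] attains its minimum there, which is positive
    by pointedness; homogeneity does the rest. Putting pointedness after the choice of [c] provides
    a constant for every [a], so that [choice] applies. *)
Lemma pointed_bound F a : exists c, 0 <= c /\ (pointed F a ->
  forall u, nonneg u -> (forall i, i \notin a -> u i 0 = 0) ->
  `|u| <= c * `|F *m u|).
Proof.
have [irr|] := pselect (pointed F a); last by exists 0.
pose S := [set u : 'cV[R]_k | (forall i, 0 <= u i 0 /\ (i \notin a -> u i 0 = 0))
   /\ `|u| = 1].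
have normc : continuous (fun u : 'cV[R]_k => `|u|) by exact: norm_continuous.
have Scpt : compact S.
  apply: (@cV_bounded_closed_compact _ _ _ 1) => [u [_ ->]//|].
  apply: closedI.
    apply: closed_setforall => i; apply: closedI.
      exact: (closed_coord (P := [set x | 0 <= x]) (@closed_ge R 0)).
    case: (i \notin a).
      rewrite (_ : (fun _ => _) = [set u : 'cV[R]_k | [set 0] (u i 0)]).
        exact: closed_coord (@closed_eq R 0).
      by apply/seteqP; split=> u /= => [->//|->].
    rewrite (_ : (fun _ => _) = setT); first exact: closedT.
    by apply/seteqP; split.
  by apply: (closed_comp _ (@closed_eq R 1)) => u _; exact: normc.
(* The slice can be empty, for instance when [a] is; the face is then reduced to 0. *)
have [S0|Sn0] := eqVneq S set0.
  exists 0; split=> // _ u u0 ua; have [->|un0] := eqVneq u 0.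
    by rewrite normr0 mul0r.
  have : S (`|u|^-1 *: u).
    split=> [i|]; last by rewrite normrZ normfV normr_id mulVf ?normr_eq0.
    by rewrite mxE; split=> [|/ua ->]; [rewrite mulr_ge0// invr_ge0|rewrite mulr0].
  by rewrite S0.
have [u1 + u1min] : exists2 c, c \in S &
    forall t, t \in S -> `|F *m c| <= `|F *m t|.
  apply: (@compact_EVT_min _ _ (fun u => `|F *m u|)) => //; first exact/set0P.
  apply: continuous_subspaceT => u.
  apply: continuous_comp; first exact: mulmx_continuous.
  exact: norm_continuous.
rewrite inE => -[u1S u1n].
have Fu1 : 0 < `|F *m u1|.
  rewrite normr_gt0; apply/eqP => /irr u10.
  have : u1 = 0.
    by apply: u10 => i; [have [] := u1S i|move=> ia; have [_ ->] := u1S i].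
  by move=> u1e; move: u1n; rewrite u1e normr0 => /eqP; rewrite eq_sym oner_eq0.
exists (`|F *m u1|^-1); split=> [|_ u u0 ua]; first by rewrite invr_ge0.
have [->|un0] := eqVneq u 0; first by rewrite normr0 mulr_ge0// invr_ge0.
have nu0 : 0 < `|u| by rewrite normr_gt0.
have : (`|u|^-1 *: u) \in S.
  rewrite inE; split=> [i|]; last by rewrite normrZ normfV normr_id mulVf ?normr_eq0.
  by rewrite mxE; split=> [|/ua ->]; [rewrite mulr_ge0// invr_ge0|rewrite mulr0].
move=> /u1min; rewrite -scalemxAr normrZ normfV normr_id.
by rewrite ler_pdivlMl// ler_pdivlMl// mulrC.
Qed.

(** After reduction to a pointed support, the constant depends on that support alone. There are
    finitely many supports, so the sum of their constants serves for all. *)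
Lemma nonneg_hoffman F : exists c, 0 <= c /\ forall u, nonneg u ->
  exists u', [/\ nonneg u', forall i, u' i 0 <= u i 0, F *m u' = F *m u &
    `|u'| <= c * `|F *m u|].
Proof.
have [c c_] := choice (pointed_bound F).
exists (\sum_a c a); split=> [|u u0]; first by apply: sumr_ge0 => a _; case: (c_ a).
have [u' [u'0 u'u Fu' irr]] := pointed_reduction F u0.
exists u'; split=> //.
have := (c_ (supp u')).2 irr u' u'0.
rewrite Fu' => h; apply: le_trans (h _) _.
  by move=> i; rewrite inE negbK => /eqP.
rewrite ler_wpM2r// (bigD1 (supp u'))//= lerDl.
by apply: sumr_ge0 => a _; case: (c_ a).
Qed.

End Conformal.

(** Flipping the signs of the negative coordinates moves [d] into the nonnegative orthant, where
    [nonneg_hoffman] applies to [F] composed with the flip. Summing over the finitely many sign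
    patterns makes the constant independent of [d]. *)
Lemma conformal_hoffman (R : realType) p k (F : 'M[R]_(p, k)) :
  exists c : R, 0 <= c /\ forall d, exists d',
    [/\ conformal d' d, F *m d' = F *m d & `|d'| <= c * `|F *m d|].
Proof.
pose sg (s : {set 'I_k}) : 'M[R]_k := diag_mx (\row_i (-1) ^+ (i \in s)).
have [c c_] := choice (fun s => nonneg_hoffman (F *m sg s)).
exists (\sum_s c s); split=> [|d]; first by apply: sumr_ge0 => s _; case: (c_ s).
pose s : {set 'I_k} := finset (fun i => d i 0 < 0).
pose u : 'cV[R]_k := \col_i `|d i 0|.
have sgE w i : (sg s *m w : 'cV[R]_k) i 0 = (-1) ^+ (i \in s) * w i 0.
  by rewrite mul_diag_mx !mxE.
have dE : d = sg s *m u.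
  apply/matrixP => i j; rewrite ord1 sgE mxE inE.
  by rewrite [LHS]realEsign ?num_real.
have [|u' [u'0 u'u Fu' u'c]] := (c_ s).2 u; first by move=> i; rewrite mxE.
exists (sg s *m u'); split.
- move=> i; rewrite sgE; have := u'u i; have := u'0 i; rewrite mxE inE.
  case: ltP => di u'0i; [rewrite ltr0_norm// expr1|rewrite ger0_norm// expr0].
    by move=> ?; right; apply/andP; split; lra.
  by move=> ?; left; apply/andP; split; lra.
- by rewrite mulmxA Fu' -mulmxA -dE.
- apply: (@le_trans _ _ `|u'|).
    apply: mx_norm_le => // i j; rewrite ord1 sgE normrM normrX normrN1 expr1n mul1r.
    exact: le_mx_norm.
  apply: le_trans u'c _; rewrite -mulmxA -dE ler_wpM2r// (bigD1 s)//= lerDl.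
  by apply: sumr_ge0 => s' _; case: (c_ s').
Qed.

(** * Linear complementarity *)

(* Registers matrices over [R] as a [completeNormedModType]. *)
HB.instance Definition _ (R : realType) p q := Complete.on 'M[R]_(p, q).

(** All terms of the inner product are nonpositive, so a zero sum forces each of them to vanish. *)
Lemma complP_pointwise (R : realType) m (z e : 'cV[R]_m) :
  complP z e <-> forall i, [/\ 0 <= e i 0, z i 0 <= 0 & e i 0 * z i 0 = 0].
Proof.
split=> [[e0 [z0 ez]] i|h]; last first.
  split; first by move=> i; case: (h i).
  split; first by move=> i; case: (h i).
  by apply: big1 => i _; case: (h i).
split=> //; apply/eqP; rewrite -oppr_eq0 -mulrN; apply/eqP.
have ge0 (j : 'I_m) : true -> 0 <= e j 0 * - z j 0.
  by move=> _; rewrite mulr_ge0 ?oppr_ge0.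
apply: (psumr_eq0P ge0) => //; apply/eqP; rewrite -oppr_eq0 -sumrN.
by under eq_bigr do rewrite mulrN opprK; rewrite -/(dotv e z) ez.
Qed.

Lemma conformal_ge0 (R : realType) k (u' u : 'cV[R]_k) i :
  conformal u' u -> 0 <= u i 0 -> 0 <= u' i 0.
Proof. by move=> /(_ i)[|] /andP[h1 h2] u0 => //; lra. Qed.

Lemma conformal_le0 (R : realType) k (u' u : 'cV[R]_k) i :
  conformal u' u -> u i 0 <= 0 -> u' i 0 <= 0.
Proof. by move=> /(_ i)[|] /andP[h1 h2] u0 => //; lra. Qed.

Lemma conformal_eq0 (R : realType) k (u' u : 'cV[R]_k) i :
  conformal u' u -> u i 0 = 0 -> u' i 0 = 0.
Proof. by move=> /(_ i)[|] /andP[h1 h2] u0; apply/eqP; rewrite eq_le; lra. Qed.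

(* Near a given point the image only involves points of [S] of bounded norm, so
   it coincides there with the image of a compact set. *)
Lemma closed_conformal_image (R : realType) p k (F : 'M[R]_(p, k))
    (S : set 'cV[R]_k) :
  closed S -> (forall u' u, conformal u' u -> S u -> S u') ->
  closed ((fun u => F *m u) @` S).
Proof.
move=> Scl Sconf; have [c [c0 Fc]] := conformal_hoffman F.
move=> q qcl; pose b := c * (`|q| + 1).
pose K := (fun u => F *m u) @` (S `&` [set u | `|u| <= b]).
have Kcl : closed K.
  apply: compact_closed; first exact: norm_hausdorff.
  apply: continuous_compact.
    by apply: continuous_subspaceT => u; exact: mulmx_continuous.
  apply: (@cV_bounded_closed_compact _ _ _ b) => [u []//|].
  apply: closedI => //.
  by apply: (closed_comp _ (@closed_le _ b)) => u _; exact: norm_continuous.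
have [u [Su _] <-] : K q; last by exists u.
apply: closed_approx Kcl _ => e e0.
(* The bound [e] gives the approximation; the bound 1 gives [|F u| <= |q| + 1], which is what [b]
   was chosen for. *)
have [|_ [[u Su <-] uq]] := qcl (ball q (Order.min e 1)).
  by apply: nbhsx_ballx; rewrite lt_min e0/=.
move: uq; rewrite -ball_normE /= distrC lt_min => /andP[ue u1].
have [u' [u'u Fu' u'c]] := Fc u.
exists (F *m u'); last by rewrite Fu'.
exists u' => //; split; first exact: Sconf Su.
rewrite /= (le_trans u'c)// ler_wpM2l//.
by rewrite -lerBlDl (le_trans (lerB_dist _ _))// ltW.
Qed.

(** Pairs are stacked with [e] above [z], here and in all later uses. *)
Lemma closed_complementarity (R : realType) m :
  closed [set u : 'cV[R]_(m + m) | complP (dsubmx u) (usubmx u)].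
Proof.
rewrite (_ : mkset _ = [set u : 'cV[R]_(m + m) | forall i,
    [/\ 0 <= u (lshift m i) 0, u (rshift m i) 0 <= 0
      & u (lshift m i) 0 * u (rshift m i) 0 = 0]]); last first.
  apply/seteqP; split=> u /=.
    by move=> /complP_pointwise h i; have := h i; rewrite !mxE.
  by move=> h; apply/complP_pointwise => i; have := h i; rewrite !mxE.
apply: closed_setforall => i.
rewrite (_ : (fun _ => _) = [set u : 'cV[R]_(m + m) | 0 <= u (lshift m i) 0] `&`
   ([set u : 'cV[R]_(m + m) | u (rshift m i) 0 <= 0] `&`
   [set u | u (lshift m i) 0 * u (rshift m i) 0 = 0])); last first.
  by apply/seteqP; split=> u /=; [case|move=> [? []]].
apply: closedI.
  exact: (closed_coord (P := [set x | 0 <= x]) (@closed_ge R 0)).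
apply: closedI.
  exact: (closed_coord (P := [set x | x <= 0]) (@closed_le R 0)).
apply: (closed_comp _ (@closed_eq R 0)) => u _.
by apply: continuousM; exact: coord_continuous.
Qed.

Lemma conformal_complP (R : realType) m (u' u : 'cV[R]_(m + m)) :
  conformal u' u -> complP (dsubmx u) (usubmx u) ->
  complP (dsubmx u') (usubmx u').
Proof.
move=> c /complP_pointwise h; apply/complP_pointwise => i.
have [] := h i; rewrite !mxE => e0 z0 /eqP; rewrite mulf_eq0 => ez; split.
- exact: conformal_ge0 e0.
- exact: conformal_le0 z0.
- case/orP: ez => /eqP ez; first by rewrite (conformal_eq0 c ez) mul0r.
  by rewrite (conformal_eq0 c ez) mulr0.
Qed.

Lemma closed_PplusD_graph (R : realType) n m (B : 'M[R]_(n, m)) (D : 'M[R]_m) :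
  closed [set q : 'cV[R]_(m + n) |
    exists z, PplusD D z (usubmx q) /\ dsubmx q = B *m z].
Proof.
have := closed_conformal_image (F := block_mx 1%:M D 0 B)
  (@closed_complementarity R m) (@conformal_complP R m).
congr closed; apply/seteqP; split=> q /=.
  move=> [u uc <-]; exists (dsubmx u).
  rewrite -[u in X in _ *m X]vsubmxK mul_block_col col_mxKu col_mxKd.
  rewrite mul1mx mul0mx add0r.
  by split=> //; exists (usubmx u).
move=> [z [[e [ez qe]] qz]]; exists (col_mx e z); first by rewrite col_mxKu col_mxKd.
by rewrite mul_block_col mul1mx mul0mx add0r -qe -qz vsubmxK.
Qed.

(** * Strongly monotone linear complementarity problems *)

Section StronglyMonotone.
Variables (R : realType) (m : nat) (M : 'M[R]_m) (mu : R).
Hypothesis mu0 : 0 < mu.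
Hypothesis Mmu : forall z, mu * dotv z z <= dotv z (M *m z).

Lemma projection_step_contraction : exists tau kappa,
  [/\ 0 < tau, 0 <= kappa < 1 & forall z,
    dotv (z - tau *: (M *m z)) (z - tau *: (M *m z)) <= kappa * dotv z z].
Proof.
(* [K] dominates [|M z|^2 / |z|^2], and also [mu^2] so that [kappa >= 0]. The squared norm is at
   most [(1 - 2 tau mu + tau^2 K) |z|^2], and [tau = mu / K] minimises this factor. *)
pose K := m%:R * (m%:R * `|M|) ^+ 2 + mu ^+ 2 + 1.
have s1 : 0 <= m%:R * (m%:R * `|M|) ^+ 2 by rewrite mulr_ge0// sqr_ge0.
have s2 : 0 < mu ^+ 2 by rewrite exprn_gt0.
have K0 : 0 < K by rewrite /K; lra.
exists (mu / K), (1 - mu ^+ 2 / K); split; first by rewrite divr_gt0.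
  rewrite gtrBl divr_gt0// andbT subr_ge0 ler_pdivrMr// mul1r.
  by rewrite /K; lra.
move=> z; set w := M *m z.
have wK : dotv w w <= K * dotv z z.
  apply: (le_trans (dotv_le_mx_norm w)).
  apply: (@le_trans _ _ (m%:R * (m%:R * `|M| * `|z|) ^+ 2)).
    by rewrite ler_wpM2l// lerXn2r ?nnegrE ?mulr_ge0// mx_norm_mul.
  rewrite exprMn mulrA ler_pM ?sqr_ge0 ?mx_norm_le_dotv//.
  by rewrite /K -addrA lerDl addr_ge0// ltW.
rewrite dotvBl !dotvBr !dotvZl !dotvZr (dotvC w z).
have zw := Mmu z; rewrite -/w in zw.
set t := mu / K; have t0 : 0 < t by rewrite divr_gt0.
have tK : t * K = mu by rewrite /t divfK ?gt_eqF.
have -> : mu ^+ 2 / K = mu * t by rewrite /t expr2 mulrA.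
have h1 : t * (mu * dotv z z) <= t * dotv z w by rewrite ler_pM2l.
have h2 : t * (t * dotv w w) <= t * (mu * dotv z z).
  by rewrite ler_pM2l// -tK -mulrA ler_pM2l.
by rewrite mulrBl mul1r; lra.
Qed.

(* Banach's theorem for an iterate of the projection step [f]: [f] contracts the
   Euclidean norm, and a high enough iterate contracts the sup norm. *)
Lemma lcp_strongly_monotone q : exists z, PplusD M z q.
Proof.
have [tau [kap [tau0 /andP[kap0 kap1] step]]] := projection_step_contraction.
pose g (z : 'cV[R]_m) := z + tau *: (q - M *m z).
(* Projection of [g z] onto the nonpositive orthant. A fixed point [z] solves the problem with
   [e = q - M z]. *)
pose f (z : 'cV[R]_m) : 'cV[R]_m := \col_i Order.min (g z i 0) 0.
have fE z w : dotv (f z - f w) (f z - f w) <= kap * dotv (z - w) (z - w).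
  apply: le_trans (step _).
  have -> : z - w - tau *: (M *m (z - w)) = g z - g w.
    by rewrite /g mulmxBr !scalerBr; apply/matrixP => i j; rewrite !mxE; ring.
  have nonexpansive (a b : R) : `|Order.min a 0 - Order.min b 0| <= `|a - b|.
    have := ler_norm (a - b); have := ler_norm (b - a); rewrite distrC.
    rewrite ler_norml; case: (leP a 0) => ?; case: (leP b 0) => ? *;
      by apply/andP; split; lra.
  apply: ler_sum => i _; rewrite -!expr2 -[leLHS]real_normK ?num_real//.
  rewrite -[leRHS]real_normK ?num_real// lerXn2r ?nnegrE//.
  have -> : (f z - f w) i 0 = Order.min (g z i 0) 0 - Order.min (g w i 0) 0.
    by rewrite !mxE.
  by apply: le_trans (nonexpansive _ _) _; rewrite !mxE.
have iterE N z w : dotv (iter N f z - iter N f w) (iter N f z - iter N f w)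
    <= kap ^+ N * dotv (z - w) (z - w).
  elim: N => [|N IH]; first by rewrite expr0 mul1r.
  by rewrite !iterS (le_trans (fE _ _))// exprS -mulrA ler_wpM2l.
(* The factor [m] is the cost of passing from the squared Euclidean norm to the squared sup norm,
   and 1/4 is the square of the contraction ratio 1/2. Using [m.+1] also ensures [kap ^+ N < 1] when
   [m = 0]. *)
have [N Nm] : exists N, kap ^+ N * m.+1%:R < 2^-2.
  have := @cvg_geometric R m.+1%:R kap; rewrite ger0_norm// => /(_ kap1).
  move/cvgrPdist_lt => /(_ (2^-2)) []; first by [].
  move=> N _ /(_ N (leqnn N)) /=.
  rewrite sub0r normrN ger0_norm ?mulr_ge0 ?exprn_ge0//.
  by rewrite mulrC => ?; exists N.
pose F : {fun [set: 'cV[R]_m] >-> [set: 'cV[R]_m]} :=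
  [fun of totalfun (iter N f)].
have [|||p _ pF] := @banach_fixed_point R 'cV[R]_m setT F.
- exists (2^-1)%:nng; split=> /=; first by lra.
  move=> [z w] _ /=; rewrite -(@ler_pXn2r _ 2) ?nnegrE ?mulr_ge0//.
  apply: (le_trans (mx_norm_le_dotv _)); apply: (le_trans (iterE _ _ _)).
  apply: (le_trans (ler_wpM2l _ (dotv_le_mx_norm _))); first exact: exprn_ge0.
  rewrite exprMn mulrA ler_wpM2r ?sqr_ge0// exprVn (le_trans _ (ltW Nm))//.
  by rewrite ler_wpM2l ?exprn_ge0// ler_nat.
- exact: closedT.
- by exists 0.
(* [f p] is again fixed by the iterate, so [|f p - p|^2 <= kap^N |f p - p|^2] with [kap^N < 1]. *)
have fp : f p = p.
  apply/eqP; rewrite -subr_eq0; apply/eqP; apply: dotv_eq0; apply/eqP.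
  rewrite eq_le dotvv_ge0 andbT.
  have := iterE N (f p) p; rewrite -iterSr iterS.
  have -> : iter N f p = p by [].
  have kN : kap ^+ N <= kap ^+ N * m.+1%:R by rewrite ler_peMr ?exprn_ge0// ler1n.
  have := dotvv_ge0 (f p - p); nra.
exists p; exists (q - M *m p); split; last by rewrite subrK.
apply/complP_pointwise => i; have := congr1 (fun z : 'cV[R]_m => z i 0) fp.
rewrite !mxE; set e := q i 0 - _ => pi.
have {}pi : Order.min (p i 0 + tau * e) 0 = p i 0.
  by rewrite -[RHS]pi; congr (Order.min (_ + tau * _) _); rewrite /e !mxE.
move: pi; case: (leP (_ + _) 0) => h1 pe.
  have /eqP : tau * e = 0 by apply: (addrI (p i 0)); rewrite addr0.
  rewrite mulf_eq0 gt_eqF//= => /eqP e0.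
  by rewrite e0 mul0r lexx -pe.
rewrite -pe mulr0 lexx; split=> //.
by move: h1; rewrite -pe add0r => /ltW; rewrite pmulr_rge0.
Qed.

End StronglyMonotone.

Lemma closed_imS_PplusD (R : realType) m (D : 'M[R]_m) : closed (imS (PplusD D)).
Proof.
have := closed_conformal_image (F := row_mx 1%:M D)
  (@closed_complementarity R m) (@conformal_complP R m).
congr closed; apply/seteqP; split=> q /=.
  move=> [u uc <-]; exists (dsubmx u), (usubmx u).
  by rewrite -[u in X in _ *m X]vsubmxK mul_row_col mul1mx.
move=> [z [e [ez ->]]]; exists (col_mx e z); first by rewrite col_mxKu col_mxKd.
by rewrite mul_row_col mul1mx.
Qed.

(** * Passivity and solvability of the resolvent equation *)

(** Pointwise dissipation inequality: at [(x, z)] the quadratic form of the passivity matrix is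
    twice the left side minus twice the right side. *)
Lemma passive_dissipation (R : realType) n m (A : 'M[R]_n) (B : 'M[R]_(n, m))
    (C : 'M[R]_(m, n)) (D : 'M[R]_m) x z : passive_half A B C D ->
  dotv x (A *m x + B *m z) <= dotv z (C *m x + D *m z).
Proof.
move=> /(_ (col_mx x z)).
rewrite -mulmxA mul_block_col tr_col_mx mul_row_col mxE -!dotvE.
rewrite !mulmxDl !mulNmx mulmxDl !dotvDr !dotvNr dotvDr.
rewrite (dotv_mul A^T) (dotv_mul C^T) (dotv_mul B^T) (dotv_mul D^T) !trmxK.
rewrite (dotvC (A *m x)) (dotvC (C *m x)) (dotvC (B *m z)) (dotvC (D *m z)); lra.
Qed.

Section Resolvent.
Variables (R : realType) (n m : nat) (A : 'M[R]_n) (B : 'M[R]_(n, m)).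
Variables (C : 'M[R]_(m, n)) (D : 'M[R]_m).
Hypothesis passive : passive_half A B C D.

(** Dissipation with [z = 0] gives [x . A x <= 0], so [A x = x] forces [x = 0]. *)
Lemma passive_resolvent_unit : 1%:M - A \in unitmx.
Proof.
rewrite -unitmx_tr unitmxE unitfE; apply/negP => /det0P[w wn0].
move=> /(congr1 trmx); rewrite trmx_mul trmxK trmx0 mulmxBl mul1mx.
move=> /eqP; rewrite subr_eq0 => /eqP wA; move/eqP: wn0; apply.
apply: trmx_inj; rewrite trmx0; apply: dotv_eq0; apply/eqP.
rewrite eq_le dotvv_ge0 andbT {2}wA.
have := passive_dissipation w^T 0 passive.
by rewrite !mulmx0 !addr0 dotv0l.
Qed.

(* Tikhonov regularisation: passivity bounds [eps * |z|^2] for the solution [z]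
   with [M] replaced by [M + eps], so the residual [eps * z] tends to 0, and the
   range of [PplusD M] is closed. *)
Lemma passive_surjective (x0 : 'cV[R]_n) (z0 e0 q0 : 'cV[R]_m) (p : 'cV[R]_n) :
  (forall i, 0 <= e0 i 0) -> (forall i, z0 i 0 <= 0) ->
  C *m x0 + q0 = e0 + D *m z0 ->
  exists x z, PplusD D z (C *m x + q0) /\ x - A *m x + B *m z = p.
Proof.
move=> e00 z00 xze.
pose G := invmx (1%:M - A).
have GK (x : 'cV[R]_n) : G *m x - A *m (G *m x) = x.
  rewrite -[X in X - _]mul1mx -mulmxBl mulmxA mulmxV ?mul1mx//.
  exact: passive_resolvent_unit.
(* Eliminating [x = G (p - B z)] leaves the complementarity problem [q = e + M z]. *)
pose M := D + C *m G *m B.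
have Mpsd z : 0 <= dotv z (M *m z).
  (* The state [x = G B z] satisfies [x = A x + B z], so dissipation reads [|x|^2 <= z . M z]. *)
  have := passive_dissipation (G *m (B *m z)) z passive.
  have /eqP := GK (B *m z); rewrite subr_eq addrC => /eqP <- h.
  apply: le_trans (dotvv_ge0 _) (le_trans h _).
  by rewrite mulmxDl addrC !mulmxA.
pose q := C *m (G *m p) + q0.
suff [z [e [ez qe]]] : imS (PplusD M) q.
  exists (G *m (p - B *m z)), z; split; last by rewrite GK subrK.
  exists e; split=> //; apply: (addIr (C *m G *m B *m z)).
  have -> : e + D *m z + C *m G *m B *m z = q by rewrite qe mulmxDl addrA.
  rewrite /q !mulmxBr !mulmxA.
  by apply/matrixP => i j; rewrite !mxE; ring.
(* [g] is the defect of the feasible point in the resolvent equation, and [c] collects what remains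
   in the estimate [eps |z|^2 / 2 <= c] after two uses of Young's inequality. *)
pose g := A *m x0 - B *m z0 - x0 + p.
pose c := dotv g g / 4 + dotv z0 z0 / 2 - dotv z0 e0.
have z0e0 : dotv z0 e0 <= 0 by apply: sumr_le0 => i _; rewrite mulr_le0_ge0.
have c0 : 0 <= c.
  by have := dotvv_ge0 g; have := dotvv_ge0 z0; rewrite /c; lra.
apply: closed_approx (@closed_imS_PplusD _ _ M) _ => d d0.
(* The residual satisfies [|eps z|^2 <= 2 c eps]; dividing by [2 c + 1] makes this strictly less
   than [d^2] and avoids a zero denominator. *)
pose eps := Order.min 1 (d ^+ 2 / (2 * c + 1)).
have d20 : 0 < d ^+ 2 / (2 * c + 1) by rewrite divr_gt0 ?exprn_gt0//; lra.
have eps0 : 0 < eps by rewrite lt_min ltr01.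
have eps1 : eps <= 1 by rewrite ge_min lexx.
have epsd : eps * (2 * c + 1) <= d ^+ 2.
  by rewrite -ler_pdivlMr ?ge_min ?lexx ?orbT//; lra.
have [|z [e [ez qe]]] := @lcp_strongly_monotone _ _ (M + eps%:M) _ eps0 _ q.
  by move=> z; rewrite mulmxDl mul_scalar_mx dotvDr dotvZr lerDr.
exists (q - eps *: z).
  by exists z, e; split=> //; rewrite qe mulmxDl mul_scalar_mx addrA addrK.
rewrite addrAC subrr add0r normrN.
suff zc : eps * dotv z z <= 2 * c.
  have : `|eps *: z| ^+ 2 <= eps * (2 * c).
    apply: le_trans (mx_norm_le_dotv _) _; rewrite dotvZl dotvZr.
    by rewrite ler_pM2l.
  move=> h; rewrite -(ltr_pXn2r (_ : 0 < 2)%N) ?nnegrE ?(ltW d0)//.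
  by apply: le_lt_trans h _; lra.
pose x := G *m (p - B *m z).
have xE : A *m x - B *m z = x - p.
  have /eqP := GK (p - B *m z); rewrite -/x subr_eq => /eqP {2}->.
  by apply/matrixP => i j; rewrite !mxE; ring.
have Cx : C *m x + q0 = e + D *m z + eps *: z.
  apply: (addIr (C *m G *m B *m z)).
  have -> : e + D *m z + eps *: z + C *m G *m B *m z = q.
    rewrite qe /M !mulmxDl mul_scalar_mx.
    by apply/matrixP => i j; rewrite !mxE; ring.
  rewrite /q /x !mulmxBr !mulmxA.
  by apply/matrixP => i j; rewrite !mxE; ring.
have dCx : C *m (x - x0) = (e - e0) + D *m (z - z0) + eps *: z.
  rewrite mulmxBr -(addrK q0 (C *m x)) -(addrK q0 (C *m x0)) Cx xze mulmxBr.
  by apply/matrixP => i j; rewrite !mxE; ring.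
(* Compare the regularised solution with the feasible point. The input enters with a minus sign
   because the resolvent equation contains [- A x + B z]. *)
have := passive_dissipation (x - x0) (- (z - z0)) passive.
have -> : A *m (x - x0) + B *m - (z - z0) = (x - x0) - g.
  rewrite mulmxN !mulmxBr opprB /g.
  transitivity ((A *m x - B *m z) - (A *m x0 - B *m z0)).
    by apply/matrixP => i j; rewrite !mxE; ring.
  by rewrite xE; apply/matrixP => i j; rewrite !mxE; ring.
have -> : C *m (x - x0) + D *m - (z - z0) = (e - e0) + eps *: z.
  by rewrite dCx mulmxN addrAC addrK.
rewrite dotvBr dotvNl dotvDr dotvZr (dotvBl z z0) (dotvBl z z0 z) !dotvBr.
have -> : dotv z e = 0 by case: ez => _ [_ ze]; rewrite dotvC.
have zle0 : dotv z e0 <= 0.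
  by apply: sumr_le0 => i _; rewrite mulr_le0_ge0//; case: ez => _ [].
have z0e : dotv z0 e <= 0.
  by apply: sumr_le0 => i _; rewrite mulr_le0_ge0//; case: ez.
have y1 := dotv_young (x - x0) g (@ltr01 R).
have y2 := @dotv_young _ _ (2^-1) z0 z ltac:(lra).
rewrite mul1r invr1 mul1r in y1.
have h1 : eps * dotv z0 z <= eps * (2^-1 * dotv z0 z0 + 2^-1^-1 * dotv z z / 4).
  by rewrite ler_pM2l.
have h2 : eps * dotv z0 z0 <= dotv z0 z0 by rewrite ler_piMl ?dotvv_ge0.
rewrite invrK in h1; rewrite -(dotvBr (x - x0) x) /c; lra.
Qed.

End Resolvent.
(** A feasible complementarity problem with positive semidefinite matrix is solvable: apply
    [passive_surjective] to the system with [A], [B], [C] zero, which is passive because dissipation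
    at [x = 0] gives [z . D z >= 0]. *)
Lemma im_PplusD_feasible (R : realType) n m (A : 'M[R]_n) (B : 'M[R]_(n, m))
    (C : 'M[R]_(m, n)) (D : 'M[R]_m) (e z : 'cV[R]_m) : passive_half A B C D ->
  (forall i, 0 <= e i 0) -> (forall i, z i 0 <= 0) ->
  imS (PplusD D) (e + D *m z).
Proof.
move=> passive e0 z0.
have passive0 : passive_half (0 : 'M[R]_n) 0 0 D.
  move=> u; have := passive_dissipation 0 (dsubmx u) passive.
  rewrite dotv0l mulmx0 add0r => h.
  rewrite -[u]vsubmxK -mulmxA mul_block_col tr_col_mx mul_row_col mxE -!dotvE.
  rewrite !trmx0 !addr0 !subr0 !mul0mx addr0 add0r dotvC dotv0l add0r mulNmx dotvNr.
  by rewrite mulmxDl dotvDr (dotv_mul D^T) trmxK (dotvC (D *m _)) oppr_le0 addr_ge0.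
have [|x [z' [zP _]]] :=
    @passive_surjective _ _ _ 0 0 0 D passive0 0 z e (e + D *m z) 0 e0 z0.
  by rewrite mul0mx add0r.
by exists z'; move: zP; rewrite mul0mx add0r.
Qed.

(** * The set-valued operator *)

Section Operator.
Variables (R : realType) (n m : nat) (A : 'M[R]_n) (B : 'M[R]_(n, m)).
Variables (C : 'M[R]_(m, n)) (D : 'M[R]_m) (v : R -> 'cV[R]_m).

Lemma complP_monotone (z1 e1 z2 e2 : 'cV[R]_m) :
  complP z1 e1 -> complP z2 e2 -> 0 <= dotv (z1 - z2) (e1 - e2).
Proof.
move=> [e10 [z10 ez1]] [e20 [z20 ez2]].
rewrite dotvBl !dotvBr !(dotvC _ e1) !(dotvC _ e2) ez1 ez2 sub0r subr0.
have h1 : dotv e2 z1 <= 0 by apply: sumr_le0 => i _; rewrite mulr_ge0_le0.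
have h2 : dotv e1 z2 <= 0 by apply: sumr_le0 => i _; rewrite mulr_ge0_le0.
lra.
Qed.

(** Monotonicity combines dissipation with the monotonicity of [complP]. The nonempty domain
    supplies the feasible point from which [passive_surjective] starts. *)
Lemma HP_maximal_monotone t : passive_half A B C D ->
  (exists x, domS (HP A B C D v t) x) -> maximal_monotone (HP A B C D v t).
Proof.
move=> passive [x0 [_ [z0 [[e0 [[e00 [z00 _]] xze]] _]]]]; split.
  move=> x1 y1 x2 y2 [z1 [[e1 [ez1 q1]] ->]] [z2 [[e2 [ez2 q2]] ->]].
  have := passive_dissipation (x1 - x2) (- (z1 - z2)) passive.
  have -> : C *m (x1 - x2) + D *m - (z1 - z2) = e1 - e2.
    rewrite mulmxN !mulmxBr -(addrK (v t) (C *m x1)) q1 -(addrK (v t) (C *m x2)) q2.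
    by apply/matrixP => i j; rewrite !mxE; ring.
  have -> : - (A *m x1) + B *m z1 - (- (A *m x2) + B *m z2) =
      - (A *m (x1 - x2) + B *m - (z1 - z2)).
    by rewrite mulmxN !mulmxBr; apply/matrixP => i j; rewrite !mxE; ring.
  rewrite dotvNl dotvNl dotvC oppr_ge0 => h; apply: le_trans h _.
  by rewrite oppr_le0 complP_monotone.
move=> G' G'mono HG x y Gxy.
(* Minty's argument: with [y1] in [H(x1)] and [x1 + y1 = x + y], monotonicity of [G'] gives
   [- |x - x1|^2 >= 0]. *)
have [x1 [z [zq zp]]] := passive_surjective passive (x + y) e00 z00 xze.
pose y1 := - (A *m x1) + B *m z.
have H1 : HP A B C D v t x1 y1 by exists z.
have y1E : y1 = x + y - x1.
  by rewrite -zp /y1; apply/matrixP => i j; rewrite !mxE; ring.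
have := G'mono _ _ _ _ Gxy (HG _ _ H1).
have -> : y - y1 = - (x - x1).
  by rewrite y1E; apply/matrixP => i j; rewrite !mxE; ring.
rewrite dotvNl oppr_ge0 => h.
have /eqP : x - x1 = 0 by apply: dotv_eq0; apply/eqP; rewrite eq_le h dotvv_ge0.
rewrite subr_eq0 => /eqP xx1; suff -> : y = y1 by rewrite xx1.
by rewrite y1E xx1 addrC addKr.
Qed.

Lemma HP_PplusD_graph t x y : HP A B C D v t x y <->
  exists z, PplusD D z (usubmx (col_mx (C *m x + v t) (y + A *m x)))
    /\ dsubmx (col_mx (C *m x + v t) (y + A *m x)) = B *m z.
Proof.
rewrite col_mxKu col_mxKd; split=> -[z [zq yz]]; exists z; split=> //.
  by rewrite yz addrAC addNr add0r.
by rewrite -yz addrC addrK.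
Qed.

Lemma HP_osc (ts : R) (tl : nat -> R) (xl yl : nat -> 'cV[R]_n) x y :
  (v \o tl) @ \oo --> v ts -> xl @ \oo --> x -> yl @ \oo --> y ->
  (forall l, HP A B C D v (tl l) (xl l) (yl l)) -> HP A B C D v ts x y.
Proof.
move=> vl xlx yly Hl; apply/HP_PplusD_graph.
pose q l : 'cV[R]_(m + n) := col_mx C A *m xl l +
  (col_mx 0 1%:M *m yl l + col_mx 1%:M 0 *m v (tl l)).
have qE x' y' v' :
    col_mx C A *m x' + (col_mx 0 1%:M *m y' + col_mx 1%:M 0 *m v')
    = col_mx (C *m x' + v') (y' + A *m x') :> 'cV[R]_(m + n).
  rewrite !mul_col_mx !mul0mx !mul1mx !add_col_mx add0r addr0.
  by rewrite [A *m x' + y']addrC.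
apply: (@closed_cvg _ _ \oo _ q _ (@closed_PplusD_graph _ _ _ B D)).
  by apply: nearW => l; rewrite /q qE; exact/HP_PplusD_graph.
rewrite -qE; apply: cvgD.
  by apply: (continuous_cvg _ _ xlx); exact: mulmx_continuous.
apply: cvgD; first by apply: (continuous_cvg _ _ yly); exact: mulmx_continuous.
by apply: (continuous_cvg _ _ vl); exact: mulmx_continuous.
Qed.

Lemma HP_closed t x : closed (HP A B C D v t x).
Proof.
pose f (y : 'cV[R]_n) : 'cV[R]_(m + n) :=
  col_mx (C *m x + v t) (A *m x) + col_mx 0 1%:M *m y.
have fE y : f y = col_mx (C *m x + v t) (y + A *m x).
  by rewrite /f mul_col_mx mul0mx mul1mx add_col_mx addr0 [A *m x + y]addrC.
have := @closed_PplusD_graph _ _ _ B D.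
move=> /(@closed_comp _ _ f) h; have {}h := h _.
rewrite (_ : HP _ _ _ _ _ _ _ = f @^-1` [set q | exists z, PplusD D z (usubmx q)
   /\ dsubmx q = B *m z]); last first.
  by apply/seteqP; split=> y /=; rewrite fE => /HP_PplusD_graph.
apply: h => y _; apply: (@lipschitz_continuous_norm _ _ _
  (n%:R * `|col_mx 0 1%:M : 'M[R]_(m + n, n)|)).
move=> y1 y2; rewrite /f opprD addrACA subrr add0r -mulmxBr; exact: mx_norm_mul.
Qed.

Lemma HP_bounded_selection : exists a : R, 0 <= a /\ forall t x,
  domS (HP A B C D v t) x ->
  exists2 y, HP A B C D v t x y & normv y <= a * (normv x + `|v t|).
Proof.
have [c [c0 Fc]] := conformal_hoffman (row_mx 1%:M D).
(* The two summands bound [A x] and [B z]; inside the second, [c] comes from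
   [|z| <= c |C x + v(t)|]. *)
pose a1 := n%:R * `|A| + m%:R * `|B| * (c * (n%:R * `|C| + 1)).
have a10 : 0 <= a1 by rewrite /a1 !(addr_ge0, mulr_ge0).
exists (n%:R * a1); split=> [|t x [_ [z [[e [ez qe]] _]]]]; first by rewrite mulr_ge0.
have [u' [uc Fu' u'c]] := Fc (col_mx e z).
rewrite mul_row_col mul1mx -qe in Fu' u'c.
exists (- (A *m x) + B *m dsubmx u').
  exists (dsubmx u'); split=> //; exists (usubmx u'); split.
    by apply: conformal_complP uc _; rewrite col_mxKu col_mxKd.
  by rewrite -Fu' -[u' in LHS]vsubmxK mul_row_col mul1mx.
apply: le_trans (normv_le_mx_norm _) _; rewrite -mulrA ler_wpM2l//.
have xn := mx_norm_le_normv x.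
have v0 := normr_ge0 (v t).
have zu : `|dsubmx u'| <= `|u'|.
  apply: mx_norm_le => // i j; rewrite mxE; exact: le_mx_norm.
have h1 : `|A *m x| <= n%:R * `|A| * (normv x + `|v t|).
  by apply: le_trans (mx_norm_mul _ _) _; rewrite ler_wpM2l ?mulr_ge0//; lra.
have h2 : `|C *m x + v t| <= (n%:R * `|C| + 1) * (normv x + `|v t|).
  apply: le_trans (ler_normD _ _) _; rewrite mulrDl mul1r lerD//; last first.
    by have := normr_ge0 x; lra.
  by apply: le_trans (mx_norm_mul _ _) _; rewrite ler_wpM2l ?mulr_ge0//; lra.
have h3 : `|B *m dsubmx u'| <=
    m%:R * `|B| * (c * ((n%:R * `|C| + 1) * (normv x + `|v t|))).
  apply: le_trans (mx_norm_mul _ _) _; rewrite ler_wpM2l ?mulr_ge0//.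
  by apply: le_trans zu (le_trans u'c _); rewrite ler_wpM2l.
apply: le_trans (ler_normD _ _) _; rewrite normrN /a1 mulrDl lerD//.
by rewrite -!mulrA in h3 *.
Qed.

(** The values no larger in norm than a given one form a compact set, on which the norm attains its
    minimum. *)
Lemma HP_least_norm t x : domS (HP A B C D v t) x ->
  exists2 y, HP A B C D v t x y &
    forall y', HP A B C D v t x y' -> normv y <= normv y'.
Proof.
move=> [y0 Hy0].
pose K := HP A B C D v t x `&` [set y | normv y <= normv y0].
have Kc : compact K.
  apply: (@cV_bounded_closed_compact _ _ _ (normv y0)) => [y [_ /= yy0]|].
    exact: le_trans (mx_norm_le_normv _) yy0.
  apply: closedI; first exact: HP_closed.
  by apply: (closed_comp _ (@closed_le _ (normv y0))) => y _; exact: normv_continuous.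
have K0 : K !=set0 by exists y0; split=> //=.
have [|y] := compact_EVT_min K0 Kc (f := @normv R n).
  by apply: continuous_subspaceT => y; exact: normv_continuous.
rewrite inE => -[Hy yy0] ymin; exists y => // y' Hy'.
have [y'0|/ltW y'0] := leP (normv y') (normv y0); last exact: le_trans y'0.
by apply: ymin; rewrite inE; split.
Qed.

(** With [(e, z, x)] as unknown, feasibility at time [t] is [F u = v t] plus signs on [e] and [z].
    Move from a solution at [s] towards one at [t] along a conformal part of their difference whose
    size is controlled by [v t - v s]. *)
Lemma HP_dom_lipschitz : passive_half A B C D -> exists a : R, 0 <= a /\
  forall s t x, domS (HP A B C D v s) x -> domS (HP A B C D v t) !=set0 ->
  exists2 x', domS (HP A B C D v t) x' & normv (x - x') <= a * `|v t - v s|.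
Proof.
move=> passive.
pose F : 'M[R]_(m, (m + m) + n) := row_mx (row_mx 1%:M D) (- C).
have [c [c0 Fc]] := conformal_hoffman F.
have FE e z x : F *m col_mx (col_mx e z) x = e + D *m z - C *m x.
  by rewrite !mul_row_col mul1mx mulNmx.
exists (n%:R * c); split=> [|s t x0]; first by rewrite mulr_ge0.
move=> [_ [z0 [[e0 [[e00 [z00 _]] q0]] _]]].
move=> [x1 [_ [z1 [[e1 [[e10 [z10 _]] q1]] _]]]].
pose u0 := col_mx (col_mx e0 z0) x0; pose u1 := col_mx (col_mx e1 z1) x1.
have Fu0 : F *m u0 = v s by rewrite FE -q0 addrC addKr.
have Fu1 : F *m u1 = v t by rewrite FE -q1 addrC addKr.
have [d [dc Fd dn]] := Fc (u1 - u0); rewrite mulmxBr Fu0 Fu1 in Fd dn.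
pose u := u0 + d; have Fu : F *m u = v t by rewrite mulmxDr Fu0 Fd addrC subrK.
have between i :
    Order.min (u0 i 0) (u1 i 0) <= u i 0 <= Order.max (u0 i 0) (u1 i 0).
  have := dc i; rewrite !mxE => h; rewrite ge_min le_max.
  case: h => /andP[h1 h2]; apply/andP; split; apply/orP;
    by (left; lra) || (right; lra).
pose e := usubmx (usubmx u); pose z := dsubmx (usubmx u); pose x := dsubmx u.
have uE : u = col_mx (col_mx e z) x by rewrite !vsubmxK.
have e_ge0 i : 0 <= e i 0.
  have /andP[+ _] := between (lshift n (lshift m i)).
  by rewrite !col_mxEu /e !mxE => /(le_trans _); apply; rewrite le_min e00 e10.
have z_le0 i : z i 0 <= 0.
  have /andP[_] := between (lshift n (rshift m i)).
  by rewrite !col_mxEu !col_mxEd /z !mxE => /le_trans; apply; rewrite ge_max z00 z10.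
exists x.
  (* The box between [u0] and [u1] preserves signs but may lose complementarity. It is restored here
     by changing [e] and [z] while keeping [x]. *)
  have [z' z'P] := im_PplusD_feasible passive e_ge0 z_le0.
  exists (- (A *m x) + B *m z'), z'; split=> //.
  rewrite /PplusD_inv /=; suff -> : C *m x + v t = e + D *m z by [].
  by rewrite -Fu uE FE addrC subrK.
apply: le_trans (normv_le_mx_norm _) _; rewrite -mulrA ler_wpM2l//.
apply: le_trans dn; apply: mx_norm_le => // i j; rewrite ord1.
have -> : (x0 - x) i 0 = - d (rshift (m + m) i) 0.
  have -> : (x0 - x) i 0 = x0 i 0 - x i 0 by rewrite !mxE.
  have -> : x i 0 = x0 i 0 + d (rshift (m + m) i) 0.
    by rewrite /x mxE mxE col_mxEd.
  by rewrite opprD addrA subrr add0r.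
by rewrite normrN; exact: le_mx_norm.
Qed.

End Operator.

(** * Total variation of absolutely continuous functions *)

Section AbsoluteContinuity.
Variable R : realType.
Implicit Types (a b t : R) (f : R -> R) (P : seq (R * R)).

(* Intervals are encoded as (right endpoint, left endpoint), the order of the
   pairs in [zip s (a :: s)] for a partition [s] starting at [a]. *)
Definition intervals_in a b P :=
  all (fun x => [&& a <= x.2, x.2 <= x.1 & x.1 <= b]) P.

Definition nonoverlapping (x y : R * R) := (x.1 <= y.2) || (y.1 <= x.2).

Definition total_length P := \sum_(x <- P) (x.1 - x.2).

Definition total_increment f P := \sum_(x <- P) `|f x.1 - f x.2|.

(** Sequences replace indexed families so that partitions can be concatenated. *)
Lemma abs_cont_intervals a b f eps : abs_cont a b f -> 0 < eps ->
  exists2 delta, 0 < delta & forall P, intervals_in a b P ->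
    pairwise nonoverlapping P -> total_length P < delta ->
    total_increment f P < eps.
Proof.
move=> fac eps0; have [delta [delta0 fd]] := fac _ eps0.
exists delta => // P Pab PP; rewrite /total_length /total_increment.
rewrite !(big_nth (0, 0)) !big_mkord.
apply: (fd _ (fun i : 'I_(size P) => (nth (0, 0) P i).2)) => [i|i j ij].
  by have /and3P[] := all_nthP (0, 0) Pab i (ltn_ord i).
have h := pairwiseP (0, 0) PP.
have [ltij|ltji|/val_inj/eqP] := ltngtP i j; last by rewrite (negbTE ij).
  by apply/orP; apply: h; rewrite ?inE.
by rewrite or_comm; apply/orP; apply: h; rewrite ?inE.
Qed.

Lemma itv_partition_intervals a b s : itv_partition a b s ->
  let P := zip s (a :: s) in
  [/\ intervals_in a b P, pairwise nonoverlapping P & total_length P = b - a].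
Proof.
elim: s a => [a /itv_partition_nil -> /=|h t IH a abs].
  by split=> //; rewrite /total_length big_nil subrr.
have ht := itv_partition_cons abs; have [hP hdisj hlen] := IH h ht.
have ah : a <= h by case: abs => /= /andP[/ltW].
have hb : h <= b := itv_partition_le ht.
split.
- rewrite /intervals_in /= lexx ah hb /=; apply: sub_all hP => x /and3P[hx -> ->].
  by rewrite (le_trans ah hx).
- rewrite /= hdisj andbT; apply: sub_all hP => x /and3P[hx _ _].
  by rewrite /nonoverlapping /= hx.
- by rewrite /total_length [zip _ _]/= big_cons -/(total_length _) hlen /=; ring.
Qed.

(** The variation is at most 1 on any interval shorter than the [delta] of [eps = 1], and finitely
    many steps of length [d / 2] reach [t0]. *)
Lemma abs_cont_total_variation_fin a b f : a <= b -> abs_cont a b f ->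
  forall t, a <= t <= b -> total_variation a t f \is a fin_num.
Proof.
move=> ab fac t0 /andP[at0 t0b].
rewrite ge0_fin_numE ?total_variation_ge0//.
have [d d0 fd] := abs_cont_intervals fac (@ltr01 R).
have small s t : a <= s -> s <= t -> t <= b -> t - s < d ->
    (total_variation s t f < +oo)%E.
  move=> as_ st tb std; apply: (@le_lt_trans _ _ 1%E); last exact: ltry.
  apply: ub_ereal_sup => _ [_ [l lst <-] <-]; rewrite lee_fin variation_zip//.
  have [lP ldisj llen] := itv_partition_intervals lst.
  apply/ltW/fd => //; last by rewrite llen.
  apply: sub_all lP => x /and3P[sx -> xt].
  by rewrite (le_trans as_ sx) (le_trans xt tb).
have steps (k : nat) t : a <= t -> t <= b -> t - a <= k%:R * (d / 2) ->
    (total_variation a t f < +oo)%E.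
  elim: k t => [|k IH] t at_ tb.
    by rewrite mul0r => ta; apply: small => //; exact: le_lt_trans ta d0.
  rewrite -natr1 mulrDl mul1r => tk.
  have [ac|ca] := leP a (t - d / 2); last by apply: small => //; lra.
  have ct : t - d / 2 <= t by lra.
  rewrite (total_variationD _ ac ct); apply: lte_add_pinfty.
    by apply: IH => //; lra.
  by apply: small => //; lra.
apply: (steps (Num.bound ((t0 - a) / (d / 2)))) => //.
rewrite -ler_pdivrMr ?divr_gt0//; apply/ltW/archi_boundP.
by rewrite divr_ge0 ?subr_ge0// divr_ge0// ltW.
Qed.

Lemma total_variation_sub a s t f : a <= s -> s <= t ->
  total_variation a t f \is a fin_num ->
  total_variation s t f =
    (fine (total_variation a t f) - fine (total_variation a s f))%:E.
Proof.
move=> as_ st; rewrite (total_variationD _ as_ st) fin_numD => /andP[fas fst].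
by rewrite fineD// addrC addKr fineK.
Qed.

(** Each interval of [P] is cut by a partition that realises its total variation up to [eta]. The
    inclusion of the pieces in intervals of [P] is what keeps [Q] nonoverlapping through the
    induction. *)
Lemma total_variation_refinement a b f P eta : a <= b -> abs_cont a b f ->
  let V t := fine (total_variation a t f) in
  0 < eta -> intervals_in a b P -> pairwise nonoverlapping P ->
  exists Q, [/\ intervals_in a b Q, pairwise nonoverlapping Q,
    forall y, y \in Q -> exists2 x, x \in P & x.2 <= y.2 /\ y.1 <= x.1,
    total_length Q <= total_length P &
    \sum_(x <- P) (V x.1 - V x.2) <= total_increment f Q + (size P)%:R * eta].
Proof.
move=> ab fac V eta0; elim: P => [_ _|x P IH /=].
  by exists [::]; split=> //; rewrite /total_increment !big_nil mul0r addr0.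
move=> /andP[/and3P[ax xx xb] Pab] /andP[xP PP].
have [Q [Qab QQ QP Qlen Qinc]] := IH Pab PP.
have TVx := total_variation_sub ax xx
  (abs_cont_total_variation_fin ab fac (introT andP (conj (le_trans ax xx) xb))).
have := @ub_ereal_sup_adherent R [set y%:E | y in variations x.2 x.1 f] _ eta0.
rewrite -/(total_variation _ _ _) TVx => /(_ isT)[_ [_ [l lx <-] <-]].
rewrite -EFinB lte_fin variation_zip// => linc.
have [lP ldisj llen] := itv_partition_intervals lx.
set L := zip l (x.2 :: l) in linc lP ldisj llen.
exists (L ++ Q); split.
- rewrite /intervals_in all_cat; apply/andP; split=> //.
  apply: sub_all lP => y /and3P[xy -> yx].
  by rewrite (le_trans ax xy) (le_trans yx xb).
- rewrite pairwise_cat ldisj QQ !andbT; apply/allrelP => y z yL zQ.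
  have /and3P[xy _ yx] := allP lP _ yL.
  have [w wP [wz zw]] := QP _ zQ.
  have := allP xP _ wP; rewrite /nonoverlapping => /orP[xw|wx]; apply/orP; [left|right].
    exact: le_trans yx (le_trans xw wz).
  exact: le_trans zw (le_trans wx xy).
- move=> y; rewrite mem_cat => /orP[yL|/QP[w wP wy]].
    by exists x; [rewrite mem_head|have /and3P[] := allP lP _ yL].
  by exists w => //; rewrite inE wP orbT.
- rewrite /total_length big_cat big_cons /=.
  by rewrite -/(total_length L) -/(total_length Q) llen lerD2l.
- rewrite big_cons /total_increment big_cat /= -/(total_increment f Q).
  rewrite -natr1 mulrDl mul1r -/(total_increment f L).
  have {}linc : V x.1 - V x.2 - eta < total_increment f L := linc.
  lra.
Qed.

Lemma abs_cont_total_variation a b f : a <= b -> abs_cont a b f ->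
  abs_cont a b (fun t => fine (total_variation a t f)).
Proof.
move=> ab fac eps eps0.
have eps20 : 0 < eps / 2 by rewrite divr_gt0.
have [d d0 fd] := abs_cont_intervals fac eps20.
exists d; split=> // N l r lr disj len.
pose P := [seq (r i, l i) | i <- enum 'I_N].
have Pab : intervals_in a b P.
  by rewrite /intervals_in all_map; apply/allP => i _ /=; have [-> [-> ->]] := lr i.
have PP : pairwise nonoverlapping P.
  rewrite pairwise_map; have := enum_uniq 'I_N; rewrite uniq_pairwise.
  by apply: sub_pairwise => i j /= /disj /orP.
have sumP (F : R * R -> R) : \sum_(x <- P) F x = \sum_(i < N) F (r i, l i).
  by rewrite big_map big_enum.
(* The [N] errors sum to less than [eps / 2], also when [N = 0]; absolute continuity of [f] on the
   refined family supplies the other half. *)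
pose eta := eps / 2 / N.+1%:R.
have eta0 : 0 < eta by rewrite divr_gt0.
have [Q [Qab QQ _ Qlen Qinc]] := total_variation_refinement ab fac eta0 Pab PP.
have lenQ : total_length Q < d.
  by apply: le_lt_trans Qlen _; rewrite /total_length sumP.
have := fd _ Qab QQ lenQ.
rewrite sumP size_map size_enum_ord /= in Qinc.
have Neta : N%:R * eta < eps / 2.
  by rewrite /eta mulrCA gtr_pMr// ltr_pdivrMr// mul1r ltr_nat.
move=> Qeps.
apply: (@le_lt_trans _ _ (total_increment f Q + N%:R * eta)); last by lra.
apply: le_trans Qinc; apply: ler_sum => i _.
have [al [lr' rb]] := lr i; rewrite ger0_norm//.
rewrite -lee_fin -total_variation_sub// ?total_variation_ge0//.
by apply: (abs_cont_total_variation_fin ab fac); rewrite rb (le_trans al lr').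
Qed.

Lemma abs_cont_sum a b (I : finType) (F : I -> R -> R) :
  (forall i, abs_cont a b (F i)) -> abs_cont a b (fun t => \sum_i F i t).
Proof.
move=> Fac eps eps0.
have eta0 : 0 < eps / #|I|.+1%:R by rewrite divr_gt0.
have [d dF] := choice (fun i => Fac i _ eta0).
(* The default value 1 keeps the minimum positive when [I] is empty. *)
exists (\big[Order.min/1]_i d i); split.
  by apply: lt_bigmin => // i _; case: (dF i).
move=> N l r lr disj len.
apply: (@le_lt_trans _ _ (\sum_i \sum_(j < N) `|F i (r j) - F i (l j)|)).
  rewrite exchange_big; apply: ler_sum => j _.
  by rewrite -sumrB ler_norm_sum.
apply: (@le_lt_trans _ _ (\sum_(i : I) eps / #|I|.+1%:R)).
  apply: ler_sum => i _; apply/ltW; apply: (dF i).2 => //.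
  by apply: lt_le_trans len _; exact: bigmin_le.
rewrite sumr_const -[ltLHS]mulr_natr -mulrA gtr_pMr// mulrC ltr_pdivrMr// mul1r.
by rewrite ltr_nat.
Qed.

Lemma abs_contZ a b (c : R) f : abs_cont a b f -> abs_cont a b (fun t => c * f t).
Proof.
move=> fac eps eps0; have c0 : 0 < `|c| + 1 by rewrite ltr_wpDl.
have [|d [d0 fd]] := fac (eps / (`|c| + 1)); first by rewrite divr_gt0.
exists d; split=> // N l r lr disj /(fd _ _ _ lr disj) h.
under eq_bigr do rewrite -mulrBr normrM.
rewrite -mulr_sumr.
apply: (@le_lt_trans _ _ ((`|c| + 1) * \sum_(i < N) `|f (r i) - f (l i)|)).
  by rewrite ler_wpM2r ?lerDl// sumr_ge0.
by rewrite mulrC -ltr_pdivlMr.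
Qed.

(** [psi] is the sum of the total variations of the coordinates. *)
Lemma abs_cont_vec_variation a b k (v : R -> 'cV[R]_k) : a <= b ->
  abs_cont_vec a b v -> exists psi : R -> R, abs_cont a b psi /\
    forall s t, a <= s -> s <= t -> t <= b -> `|v t - v s| <= psi t - psi s.
Proof.
move=> ab vac; have vi i : abs_cont a b (fun t => v t i 0).
  move=> eps /vac[d [d0 vd]]; exists d; split=> // N l r lr disj len.
  apply: le_lt_trans (vd _ _ _ lr disj len); apply: ler_sum => j _.
  by have := normv_coord (v (r j) - v (l j)) i; rewrite !mxE.
exists (fun t => \sum_i fine (total_variation a t (fun t => v t i 0))); split.
  by apply: abs_cont_sum => i; exact: abs_cont_total_variation.
move=> s t as_ st tb; rewrite -sumrB.
apply: le_trans (mx_norm_le_normv _) (le_trans (normv_le_sum _) _).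
apply: ler_sum => i _; rewrite !mxE -lee_fin -total_variation_sub//.
  exact: (total_variation_ge (fun t => v t i 0)).
by apply: (abs_cont_total_variation_fin ab (vi i)); rewrite (le_trans as_ st).
Qed.

Lemma abs_cont_vec_cvg a b k (v : R -> 'cV[R]_k) (ts : R) (tl : nat -> R) :
  abs_cont_vec a b v -> a <= ts <= b -> (forall l, a <= tl l <= b) ->
  tl @ \oo --> ts -> (v \o tl) @ \oo --> v ts.
Proof.
move=> vac /andP[ats tsb] tlab tlts; apply/cvgrPdist_lt => e e0.
have [d [d0 vd]] := vac _ e0.
have dist s t : a <= s -> s <= t -> t <= b -> t - s < d -> `|v t - v s| < e.
  move=> as_ st tb std; apply: le_lt_trans (mx_norm_le_normv _) _.
  (* A family of one interval turns absolute continuity into uniform continuity. *)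
  have := vd 1 (fun=> s) (fun=> t); rewrite !big_ord1; apply=> //.
  by move=> i j; rewrite !ord1 eqxx.
move/cvgrPdist_lt: tlts => /(_ _ d0); apply: filterS => l /= tld.
have /andP[al lb] := tlab l.
have [lts|tsl] := leP (tl l) ts.
  by apply: dist => //; apply: le_lt_trans tld; exact: ler_norm.
rewrite distrC; apply: dist => //; first exact: ltW.
by apply: le_lt_trans tld; rewrite distrC; exact: ler_norm.
Qed.

End AbsoluteContinuity.

(** * Derivation of (A1) to (A4) *)

Unset Implicit Arguments.

Theorem theorem21 (R : realType) (n m : nat) (T : R)
  (A : 'M[R]_n) (B : 'M[R]_(n, m)) (C : 'M[R]_(m, n)) (D : 'M[R]_m)
  (v : R -> 'cV[R]_m) :
  0 < T ->
  (* (i) *)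
  passive_half A B C D ->
  (* (ii) *)
  (forall t, 0 <= t <= T ->
     range (fun x : 'cV[R]_n => C *m x)
       `&` rint [set et - v t | et in imS (PplusD D)] !=set0) ->
  (* (iii) *)
  abs_cont_vec 0 T v ->
  (* (A1) *)
  (forall t, 0 <= t <= T -> maximal_monotone (HP A B C D v t)) /\
  (* (A2) *)
  (exists phi : R -> R,
     {in `[0, T] &, {homo phi : s t / s <= t}} /\ abs_cont 0 T phi /\
     forall s t, 0 <= s -> s <= t -> t <= T ->
       (ereal_sup [set distS z (domS (HP A B C D v t))
                   | z in domS (HP A B C D v s)] <= (phi t - phi s)%:E)%E) /\
  (* (A3) *)
  (forall r : R, 0 < r -> exists sigma : R -> R,
     (forall t, 0 <= t <= T -> 0 <= sigma t) /\
     (@lebesgue_measure R).-integrable [set t : R | 0 <= t <= T] (EFin \o sigma) /\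
     forall t x, 0 <= t <= T -> normv x <= r -> domS (HP A B C D v t) x ->
       exists y, HP A B C D v t x y /\
         (forall y', HP A B C D v t x y' -> normv y <= normv y') /\
         normv y <= sigma t * (1 + normv x)) /\
  (* (A4) *)
  (forall (ts : R) (tl : nat -> R) (xl yl : nat -> 'cV[R]_n) (x y : 'cV[R]_n),
     0 <= ts <= T -> (forall l, 0 <= tl l <= T) ->
     tl @ \oo --> ts ->
     (forall l, HP A B C D v (tl l) (xl l) (yl l)) ->
     xl @ \oo --> x -> yl @ \oo --> y ->
     HP A B C D v ts x y).
Proof.
move=> T0 passive cq vac.
have T0' := ltW T0.
(* A common point of the two sets in (ii) gives [x] with [C x + v t] in the image of [PplusD D]. *)
have dom_neq0 t : 0 <= t <= T -> domS (HP A B C D v t) !=set0.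
  move=> /cq[_ [[x _ <-] [[q [z zq] qx] _]]].
  exists x, (- (A *m x) + B *m z), z; split=> //.
  by rewrite /PplusD_inv /= -qx subrK.
have [psi [psiac vpsi]] := abs_cont_vec_variation T0' vac.
split; first by move=> t tT; exact: HP_maximal_monotone (dom_neq0 t tT).
split.
  have [a [a0 lip]] := HP_dom_lipschitz v passive.
  exists (fun t => a * psi t); split; last split; last 1 first.
  - move=> s t s0 st tT; apply: ub_ereal_sup => _ [x xs <-].
    have [|x' x't xx'] := lip s t x xs.
      by apply: dom_neq0; rewrite tT (le_trans s0 st).
    apply: ereal_inf_le; exists (normv (x - x'))%:E; first by exists x'.
    by rewrite lee_fin -mulrBr (le_trans xx')// ler_wpM2l// vpsi.
  - move=> s t; rewrite !in_itv /= => /andP[s0 _] /andP[_ tT] st.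
    by rewrite ler_wpM2l// -subr_ge0 (le_trans _ (vpsi _ _ s0 st tT)).
  - exact: abs_contZ.
split; last first.
  move=> ts tl xl yl x y tsT tlT tlts Hl xlx yly.
  exact: HP_osc (abs_cont_vec_cvg vac tsT tlT tlts) xlx yly Hl.
move=> r r0; have [a [a0 sel]] := HP_bounded_selection A B C D v.
(* [b] bounds [|v|] on the whole interval, since [|v t - v 0|] is at most the total increment of
   [psi]. *)
pose b := `|v 0| + (psi T - psi 0).
have psi0 : 0 <= psi T - psi 0 by apply: le_trans (vpsi _ _ _ _ _).
have vb t : 0 <= t <= T -> `|v t| <= b.
  move=> /andP[t0 tT]; rewrite -(subrK (v 0) (v t)) addrC.
  apply: le_trans (ler_normD _ _) _; rewrite lerD2l.
  apply: le_trans (vpsi _ _ (lexx 0) t0 tT) _.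
  by rewrite lerD2r -subr_ge0 (le_trans _ (vpsi _ _ t0 tT (lexx T))).
have b0 : 0 <= b by rewrite addr_ge0.
(* This comes from [|x| + |v t| <= |x| + b <= (1 + b) (1 + |x|)]. *)
exists (fun=> a * (1 + b)); split; first by move=> t _; rewrite mulr_ge0// addr_ge0.
split.
  rewrite (_ : mkset _ = `[0, T]%classic); last first.
    by apply/seteqP; split=> t /=; rewrite in_itv.
  apply: continuous_compact_integrable; first exact: segment_compact.
  by apply: continuous_subspaceT => t; exact: cvg_cst.
move=> t x tT _ xdom.
have [y Hy ymin] := HP_least_norm xdom.
have [y' Hy' y'n] := sel _ _ xdom.
exists y; split=> //; split=> //.
apply: le_trans (ymin _ Hy') (le_trans y'n _).
rewrite -mulrA ler_wpM2l//.
have xn : 0 <= normv x by exact: sqrtr_ge0.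
by have := vb _ tT; nra.
Qed.
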